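(* Let $\mathcal{C}$ be a category, $N:\mathcal{C}\to\mathcal{C}$ a functor and $\eta:\mathrm{id}_{\mathcal{C}}\to N$ a natural transformation. If $(N,\eta)$ is an idempotent semimonad on $\mathcal{C}$, then $(N,\eta)$ is an idempotent monad on $\mathcal{C}$.
   Context: $N\eta:N\to N^2$ denotes the natural transformation with components $(N\eta)_x=N(\eta_x)$, and $\eta N:N\to N^2$ the natural transformation with components $(\eta N)_x=\eta_{Nx}$. The pair $(N,\eta)$ is an idempotent semimonad on $\mathcal{C}$ when $N\eta$ and $\eta N$ are both natural isomorphisms (without requiring $N\eta=\eta N$). The pair $(N,\eta)$ is an idempotent monad on $\mathcal{C}$ when $N\eta=\eta N$ and $N\eta$ is a natural isomorphism. *)

(* Defs.v *)
From Stdlib Require Import FunctionalExtensionality ProofIrrelevance.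

Set Implicit Arguments.
Unset Strict Implicit.
Unset Printing Implicit Defensive.

(* Equality of morphisms is Leibniz equality. *)
Record Category := {
  Ob :> Type;
  Hom : Ob -> Ob -> Type;
  idm : forall x : Ob, Hom x x;
  comp : forall x y z : Ob, Hom y z -> Hom x y -> Hom x z;
  comp_idl : forall (x y : Ob) (f : Hom x y), comp (idm y) f = f;
  comp_idr : forall (x y : Ob) (f : Hom x y), comp f (idm x) = f;
  comp_assoc : forall (w x y z : Ob) (h : Hom y z) (g : Hom x y) (f : Hom w x),
    comp h (comp g f) = comp (comp h g) f
}.

Arguments Hom {C} x y : rename.
Arguments idm {C} x : rename.
Arguments comp {C x y z} g f : rename.

Declare Scope cat_scope.
Delimit Scope cat_scope with cat.
Local Open Scope cat_scope.

Notation "g \c f" := (comp g f) (at level 40, left associativity) : cat_scope.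

Definition is_iso (C : Category) (x y : C) (f : Hom x y) : Prop :=
  exists g : Hom y x, g \c f = idm x /\ f \c g = idm y.

Record Functor (C D : Category) := {
  fobj :> C -> D;
  fmap : forall x y : C, Hom x y -> Hom (fobj x) (fobj y);
  fmap_id : forall x : C, fmap (idm x) = idm (fobj x);
  fmap_comp : forall (x y z : C) (g : Hom y z) (f : Hom x y),
    fmap (g \c f) = fmap g \c fmap f
}.

Arguments fmap {C D} F {x y} f : rename.

Definition functor_id (C : Category) : Functor C C :=
  {| fobj := fun x => x;
     fmap := fun x y (f : Hom x y) => f;
     fmap_id := fun x => eq_refl;
     fmap_comp := fun x y z g f => eq_refl |}.

Lemma fmap_id_compose (C D E : Category) (G : Functor D E) (F : Functor C D)
  (x : C) : fmap G (fmap F (idm x)) = idm (G (F x)).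
Proof. now rewrite !fmap_id. Qed.

Lemma fmap_comp_compose (C D E : Category) (G : Functor D E) (F : Functor C D)
  (x y z : C) (g : Hom y z) (f : Hom x y) :
  fmap G (fmap F (g \c f)) = fmap G (fmap F g) \c fmap G (fmap F f).
Proof. now rewrite !fmap_comp. Qed.

Definition functor_comp (C D E : Category) (G : Functor D E) (F : Functor C D)
  : Functor C E :=
  {| fobj := fun x => G (F x);
     fmap := fun x y (f : Hom x y) => fmap G (fmap F f);
     fmap_id := @fmap_id_compose C D E G F;
     fmap_comp := @fmap_comp_compose C D E G F |}.

Record NatTrans (C D : Category) (F G : Functor C D) := {
  component :> forall x : C, Hom (F x) (G x);
  naturality : forall (x y : C) (f : Hom x y),
    fmap G f \c component x = component y \c fmap F f
}.

Lemma NatTrans_eq (C D : Category) (F G : Functor C D) (a b : NatTrans F G) :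
  (forall x : C, a x = b x) -> a = b.
Proof.
destruct a as [a na], b as [b nb]; simpl; intros e.
assert (ab : a = b) by now apply functional_extensionality_dep.
subst b; now rewrite (proof_irrelevance _ na nb).
Qed.

Definition is_nat_iso (C D : Category) (F G : Functor C D) (a : NatTrans F G)
  : Prop := forall x : C, is_iso (a x).

Section Whiskering.

Variables (C : Category) (N : Functor C C) (eta : NatTrans (functor_id C) N).

Lemma whisker_l_natural (x y : C) (f : Hom x y) :
  fmap (functor_comp N N) f \c fmap N (eta x) = fmap N (eta y) \c fmap N f.
Proof.
simpl; rewrite <- !fmap_comp.
exact (f_equal (fun u => fmap N u) (naturality eta f)).
Qed.

(* The source is N itself rather than [functor_comp N (functor_id C)], so that
   [whisker_l] and [whisker_r] have the same type; the components agree. *)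
Definition whisker_l : NatTrans N (functor_comp N N) :=
  {| component := fun x => fmap N (eta x) : Hom (N x) (functor_comp N N x);
     naturality := whisker_l_natural |}.

Lemma whisker_r_natural (x y : C) (f : Hom x y) :
  fmap (functor_comp N N) f \c eta (N x) = eta (N y) \c fmap N f.
Proof. exact (naturality eta (fmap N f)). Qed.

Definition whisker_r : NatTrans N (functor_comp N N) :=
  {| component := fun x => eta (N x) : Hom (N x) (functor_comp N N x);
     naturality := whisker_r_natural |}.

Definition idempotent_semimonad : Prop :=
  is_nat_iso whisker_l /\ is_nat_iso whisker_r.

Definition idempotent_monad : Prop :=
  whisker_l = whisker_r /\ is_nat_iso whisker_l.

End Whiskering.

(* Main.v *)
Require Import Defs.

(** Naturality of [eta] at the morphism [eta x] itself says that [N (eta x)] and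
    [eta (N x)] agree after precomposition with [eta x].  The proof is therefore
    a cancellation: although [eta x] need not be an epimorphism, it behaves like
    one against morphisms into an object [z] at which [eta z] is invertible
    ([unit_cancel_r]).  The target [N (N x)] is such an object, since
    [eta (N y)] is invertible for every [y]. *)

Local Open Scope cat_scope.

Lemma iso_cancel_l (C : Category) (x y z : C) (f : Hom y z) (g h : Hom x y) :
  is_iso f -> f \c g = f \c h -> g = h.
Proof.
intros [k [kf _]] e.
rewrite <- (comp_idl g), <- (comp_idl h), <- kf, <- !comp_assoc.
now rewrite e.
Qed.

Lemma iso_cancel_r (C : Category) (x y z : C) (f : Hom x y) (g h : Hom y z) :
  is_iso f -> g \c f = h \c f -> g = h.
Proof.
intros [k [_ fk]] e.
rewrite <- (comp_idr g), <- (comp_idr h), <- fk, !comp_assoc.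
now rewrite e.
Qed.

(** Applying [N] to [g \c eta x = h \c eta x] makes the common factor
    invertible, so [N g = N h]; naturality of [eta] then carries this equality
    back to [g] and [h], up to postcomposition with the invertible [eta z]. *)
Lemma unit_cancel_r (C : Category) (N : Functor C C)
  (eta : NatTrans (functor_id C) N) (x z : C) (g h : Hom (N x) z) :
  is_iso (fmap N (eta x)) -> is_iso (eta z) ->
  g \c eta x = h \c eta x -> g = h.
Proof.
intros iso_Neta iso_eta e.
assert (Ngh : fmap N g = fmap N h).
{ apply (iso_cancel_r _ _ _ _ _ _ _ iso_Neta).
  rewrite <- !(fmap_comp N).
  exact (f_equal (fun u => fmap N u) e). }
apply (iso_cancel_l _ _ _ _ _ _ _ iso_eta).
refine (eq_trans (eq_sym (naturality eta g)) (eq_trans _ (naturality eta h))).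
now rewrite Ngh.
Qed.

Theorem corollary3p13 (C : Category) (N : Functor C C)
  (eta : NatTrans (functor_id C) N) :
  idempotent_semimonad eta -> idempotent_monad eta.
Proof.
intros [iso_l iso_r]; split; [| exact iso_l].
apply NatTrans_eq; intro x.
apply (unit_cancel_r _ _ eta); [apply iso_l | apply (iso_r (N x)) |].
exact (naturality eta (eta x)).
Qed.
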